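(* Let $\alpha\in\mathbb{R}$, let $\mathbf{F}^{\alpha}\in\mathbb{C}^{N\times N}$ be the $\alpha$-th graph fractional Fourier transform matrix of an undirected weighted graph $\mathcal{G}$ with $N$ vertices, and let $\bm{f},\bm{g}\in\mathbb{R}^N$ be filters such that, with $\hat{\bm{g}}=\mathbf{F}^{\alpha}\bm{g}$, one has $0\le f_i\le 1$ and $0\le \hat{g}_i\le 1$ for all $i$, and $\|\bm{f}\|_\infty=\|\hat{\bm{g}}\|_\infty=1$. Put $\mathbf{D}_f=\mathrm{diag}(\bm{f})$, $\mathbf{B}^{\alpha}_g=\mathbf{F}^{-\alpha}\,\mathrm{diag}(\hat{\bm{g}})\,\mathbf{F}^{\alpha}$, and let $$\Gamma(\mathbf{D}_f,\mathbf{B}^{\alpha}_g)=\left\{(\bm{x}^{\mathrm{H}}\mathbf{D}_f\bm{x},\ \bm{x}^{\mathrm{H}}\mathbf{B}^{\alpha}_g\bm{x})\ \middle|\ \bm{x}\in\mathbb{C}^N,\ \|\bm{x}\|_2=1\right\}.$$ For $\beta\in[0,2\pi)$ let $\rho_1(\beta)$ be the largest eigenvalue of the Hermitian matrix $\mathbf{R}^{\alpha}_{f,g}(\beta)=\cos\beta\,\mathbf{D}_f+\sin\beta\,\mathbf{B}^{\alpha}_g$. Then for every $\beta\in[0,2\pi)$, $$\Gamma(\mathbf{D}_f,\mathbf{B}^{\alpha}_g)\subseteq\left\{(t,s)\in[0,1]^2\ \middle|\ \cos\beta\,t+\sin\beta\,s\le\rho_1(\beta)\right\},$$ and the line $\ell(\beta)=\{(t,s)\in\mathbb{R}^2\mid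 \cos\beta\,t+\sin\beta\,s=\rho_1(\beta)\}$ is a supporting line of $\Gamma(\mathbf{D}_f,\mathbf{B}^{\alpha}_g)$.
   Context: Graph: $\mathcal{G}$ is an undirected graph with vertices $v_1,\dots,v_N$ and symmetric entrywise nonnegative weighted adjacency matrix $\mathbf{W}\in\mathbb{R}^{N\times N}$; $\mathbf{K}=\mathrm{diag}(k_1,\dots,k_N)$ with $k_i=\sum_j w_{ij}$ (assumed positive so that $\mathbf{K}^{-1/2}$ exists), and the normalized Laplacian is $\bm{\mathcal{L}}=\mathbf{K}^{-1/2}(\mathbf{K}-\mathbf{W})\mathbf{K}^{-1/2}=\mathbf{U}\bm{\Xi}\mathbf{U}^{\mathrm{H}}$, with $\bm{\Xi}=\mathrm{diag}(\xi_1,\dots,\xi_N)$, $0=\xi_1\le\cdots\le\xi_N$, and $\mathbf{U}$ orthogonal. Graph fractional Fourier transform (GFRFT): write $\mathbf{U}^{\mathrm{H}}=\mathbf{Q}\mathbf{\Lambda}\mathbf{Q}^{\mathrm{H}}$ with $\mathbf{Q}$ unitary and $\mathbf{\Lambda}$ diagonal (its entries have modulus $1$, since $\mathbf{U}$ is orthogonal). For $\alpha\in\mathbb{R}$, $\mathbf{F}^{\alpha}=\mathbf{Q}\mathbf{\Lambda}^{\alpha}\mathbf{Q}^{\mathrm{H}}$ and $\mathbf{F}^{-\alpha}=\mathbf{Q}\mathbf{\Lambda}^{-\alpha}\mathbf{Q}^{\mathrm{H}}$, where $\mathbf{\Lambda}^{\alpha}$ raises each diagonal entry to the power $\alpha$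 (for a diagonal entry $e^{\mathrm{i}\theta}$ with fixed argument $\theta$, e.g. the principal one, its power is $e^{\mathrm{i}\alpha\theta}$). The GFRFT of $\bm{x}\in\mathbb{C}^N$ is $\hat{\bm{x}}=\mathbf{F}^{\alpha}\bm{x}$. A supporting line of a set $\Gamma\subset\mathbb{R}^2$ is a line that meets $\Gamma$ and such that $\Gamma$ is contained in one of the two closed half-planes bounded by it. *)

(* Defs.v *)
From mathcomp Require Import all_boot all_order all_algebra.
From mathcomp Require Import complex.
From mathcomp Require Import boolp classical_sets reals trigo.
From mathcomp Require Import interval_inference normedtype.

Set Implicit Arguments.
Unset Strict Implicit.
Unset Printing Implicit Defensive.

Import Order.TTheory GRing.Theory Num.Theory.
Local Open Scope ring_scope.
Local Open Scope classical_set_scope.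
Local Open Scope sesquilinear_scope.
Local Open Scope complex_scope.

Definition degree (R : realType) (N : nat) (W : 'M[R]_N) (i : 'I_N) : R :=
  \sum_j W i j.

Definition is_weighted_graph (R : realType) (N : nat) (W : 'M[R]_N) : Prop :=
  [/\ W^T = W, forall i j, 0 <= W i j & forall i, 0 < degree W i].

Definition normalized_laplacian (R : realType) (N : nat) (W : 'M[R]_N)
    : 'M[R]_N :=
  let K := diag_mx (\row_i degree W i) in
  let Kinvsqrt := diag_mx (\row_i (Num.sqrt (degree W i))^-1) in
  Kinvsqrt *m (K - W) *m Kinvsqrt.

Definition is_laplacian_eigenbasis (R : realType) (N : nat)
    (W U : 'M[R]_N) (xi : 'rV[R]_N) : Prop :=
  [/\ U *m U^T = 1%:M,
      normalized_laplacian W = U *m diag_mx xi *m U^T,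
      forall i : 'I_N, i = 0%N :> nat -> xi 0 i = 0
    & forall i j : 'I_N, (i <= j)%N -> xi 0 i <= xi 0 j].

Definition cmx (R : realType) (m n : nat) (A : 'M[R]_(m, n))
    : 'M[R[i]]_(m, n) := map_mx (real_complex R) A.

Definition expi (R : realType) (t : R) : R[i] := cos t +i* sin t.

(* [theta] is any fixed choice of arguments of the eigenvalues [lambda]; the
   principal one is a special case. *)
Definition is_gft_eigenbasis (R : realType) (N : nat) (U : 'M[R]_N)
    (Q : 'M[R[i]]_N) (lambda : 'rV[R[i]]_N) (theta : 'I_N -> R) : Prop :=
  [/\ Q \is unitarymx,
      (cmx U)^t* = Q *m diag_mx lambda *m Q^t*
    & forall i, lambda 0 i = expi (theta i)].

Definition gfrft (R : realType) (N : nat) (Q : 'M[R[i]]_N) (theta : 'I_N -> R)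
    (alpha : R) : 'M[R[i]]_N :=
  Q *m diag_mx (\row_i expi (alpha * theta i)) *m Q^t*.

Definition filter_mx (R : realType) (N : nat) (f : 'cV[R]_N) : 'M[R[i]]_N :=
  diag_mx (cmx f)^T.

Definition gfrft_filter_mx (R : realType) (N : nat) (Q : 'M[R[i]]_N)
    (theta : 'I_N -> R) (alpha : R) (g : 'cV[R]_N) : 'M[R[i]]_N :=
  gfrft Q theta (- alpha) *m diag_mx (gfrft Q theta alpha *m cmx g)^T
    *m gfrft Q theta alpha.

Definition l2norm (R : realType) (N : nat) (x : 'cV[R[i]]_N) : R[i] :=
  sqrtC (\sum_i `|x i 0| ^+ 2).

Definition qform (R : realType) (N : nat) (A : 'M[R[i]]_N) (x : 'cV[R[i]]_N)
    : R[i] := (x^t* *m A *m x) 0 0.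

(* For Hermitian [A] and [B] the two forms are real (see [qform_real]), so that
   taking real parts only changes the type. *)
Definition numerical_range2 (R : realType) (N : nat) (A B : 'M[R[i]]_N)
    : set (R * R) :=
  [set (complex.Re (qform A x), complex.Re (qform B x)) | x in
     [set x : 'cV[R[i]]_N | l2norm x = 1]].

Definition is_largest_eigenvalue (R : realType) (N : nat) (A : 'M[R[i]]_N)
    (r : R) : Prop :=
  eigenvalue A r%:C /\ forall z : R[i], eigenvalue A z -> z <= r%:C.

(* The default value 0 is never used for a Hermitian matrix of positive size:
   see [largest_eigenvalueP]. *)
Definition largest_eigenvalue (R : realType) (N : nat) (A : 'M[R[i]]_N) : R :=
  xget 0 [set r | is_largest_eigenvalue A r].

Definition is_supporting_line (R : realType) (L G : set (R * R)) : Prop :=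
  exists a b c : R,
    [/\ (a, b) != (0, 0),
        L = [set p | a * p.1 + b * p.2 = c],
        L `&` G !=set0
      & G `<=` [set p | a * p.1 + b * p.2 <= c] \/
        G `<=` [set p | a * p.1 + b * p.2 >= c]].

Lemma qform_real (R : realType) (N : nat) (A : 'M[R[i]]_N) (x : 'cV[R[i]]_N) :
  A \is hermsymmx -> (complex.Re (qform A x))%:C = qform A x.
Proof.
move=> /is_hermitianmxP; rewrite expr0 scale1r => hA.
apply: RRe_real; rewrite CrealE /qform; apply/eqP.
have h : (x^t* *m A *m x)^t* = x^t* *m A *m x.
  by rewrite !trmx_mul !map_mxM -hA trmxCK mulmxA.
by rewrite -[in RHS]h [in RHS]mxE [in RHS]mxE.
Qed.

Lemma eigenvalue_herm_real (R : realType) (N : nat) (A : 'M[R[i]]_N)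
    (z : R[i]) :
  A \is hermsymmx -> eigenvalue A z -> z \is Num.real.
Proof.
move=> hA /eigenvalueP[v vA vn0].
have /is_hermitianmxP := hA; rewrite expr0 scale1r => hA'.
have h1 : v *m A *m v^t* = z *: (v *m v^t*) by rewrite vA scalemxAl.
have h2 : v *m A *m v^t* = z^* *: (v *m v^t*).
  rewrite {1}hA' -mulmxA -map_mxM -trmx_mul vA linearZ /= map_mxZ.
  by rewrite scalemxAr.
have vv : (v *m v^t*) 0 0 != 0.
  rewrite mxE psumr_eq0 => [|i _]; last by rewrite !mxE mul_conjC_ge0.
  apply: contra vn0 => /allP h; apply/eqP/rowP => j.
  have := h j (mem_index_enum j); rewrite !mxE /= -normCK.
  by rewrite expf_eq0 normr_eq0 => /eqP.
have /matrixP/(_ 0 0) := etrans (esym h2) h1.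
rewrite [LHS]mxE [RHS]mxE => /(mulIf vv) e.
by rewrite CrealE; apply/eqP.
Qed.

Lemma largest_eigenvalueP (R : realType) (N : nat) (A : 'M[R[i]]_N) :
  (0 < N)%N -> A \is hermsymmx ->
  is_largest_eigenvalue A (largest_eigenvalue A).
Proof.
move=> N0 hA; apply: (@xgetPex _ 0 [set r | is_largest_eigenvalue A r]).
have [rs rsE] := closed_field_poly_normal (char_poly A).
have eigE z : eigenvalue A z = (z \in rs).
  rewrite eigenvalue_root_char rsE (monicP (char_poly_monic A)) scale1r.
  by rewrite root_prod_XsubC.
have [a] := eigenvalue_closed A N0; rewrite eigE => ars.
have i0 : (index a rs < size rs)%N by rewrite index_mem.
pose r (k : 'I_(size rs)) : R := complex.Re rs`_k.
have rE (k : 'I_(size rs)) : (r k)%:C = rs`_k.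
  by apply/RRe_real/(eigenvalue_herm_real hA); rewrite eigE mem_nth.
have [k _ kmax] := @arg_maxP _ _ _ (Ordinal i0) predT r isT.
exists (r k); split; first by rewrite rE eigE mem_nth.
move=> z; rewrite eigE => zrs.
have zi : (index z rs < size rs)%N by rewrite index_mem.
have := kmax (Ordinal zi) isT.
by rewrite /= -lecR !rE /= nth_index.
Qed.

(* Main.v *)
(** The point of the joint numerical range given by a unit vector [x] is mapped
    by the linear form [cos beta * t + sin beta * s] to the value at [x] of the
    quadratic form of [cos beta *: Df + sin beta *: Bg].  By the Rayleigh
    principle its maximum over unit vectors is the largest eigenvalue, attained
    at an eigenvector, so the line [l(beta)] touches the range and bounds it.
    The range lies in the unit square because [Df] and [Bg] are unitarily
    diagonalizable with spectrum in [[0, 1]]. *)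
Require Import Defs.
From mathcomp Require Import all_boot all_order all_algebra.
From mathcomp Require Import complex.
From mathcomp Require Import boolp classical_sets reals trigo.
From mathcomp Require Import interval_inference normedtype.

Set Implicit Arguments.
Unset Strict Implicit.
Unset Printing Implicit Defensive.

Import Order.TTheory GRing.Theory Num.Theory.
Local Open Scope ring_scope.
Local Open Scope classical_set_scope.
Local Open Scope complex_scope.
Local Open Scope sesquilinear_scope.

Lemma l2norm_eq1 (R : realType) (N : nat) (x : 'cV[R[i]]_N) :
  l2norm x = 1 <-> x^t* *m x = 1%:M.
Proof.
have sE : (x^t* *m x) 0 0 = \sum_i `|x i 0| ^+ 2.
  by rewrite mxE; apply: eq_bigr => i _; rewrite !mxE mulrC -normCK.
have -> : x^t* *m x = 1%:M <-> \sum_i `|x i 0| ^+ 2 = 1.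
  rewrite -sE; split=> [->|h]; first by rewrite mxE.
  by apply/matrixP => i j; rewrite !ord1 h mxE.
rewrite /l2norm; split=> [h|->]; last by rewrite sqrtC1.
by rewrite -[LHS]sqrtCK h expr1n.
Qed.

Section QuadraticForm.
Variables (R : realType) (N : nat).
Implicit Types (A B P : 'M[R[i]]_N) (x : 'cV[R[i]]_N) (d : 'rV[R[i]]_N).

Lemma qformD A B x : qform (A + B) x = qform A x + qform B x.
Proof. by rewrite /qform mulmxDr mulmxDl mxE. Qed.

Lemma qformZ (c : R[i]) A x : qform (c *: A) x = c * qform A x.
Proof. by rewrite /qform -scalemxAr -scalemxAl mxE. Qed.

Lemma qform1 x : l2norm x = 1 -> qform 1%:M x = 1.
Proof. by move=> /l2norm_eq1 x1; rewrite /qform mulmx1 x1 mxE. Qed.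

(** With [y = P *m x] the form becomes the sum of the [|y_i|^2] weighted by the nonnegative entries
    of [d]. *)
Lemma qform_congr_diag_ge0 P d x :
  (forall i, 0 <= d 0 i) -> 0 <= qform (P^t* *m diag_mx d *m P) x.
Proof.
move=> d0; set y := P *m x.
have -> : qform (P^t* *m diag_mx d *m P) x = \sum_i d 0 i * `|y i 0| ^+ 2.
  rewrite /qform.
  have -> : x^t* *m (P^t* *m diag_mx d *m P) *m x = y^t* *m diag_mx d *m y.
    by rewrite /y trmx_mul map_mxM !mulmxA.
  rewrite mxE; apply: eq_bigr => i _; rewrite mul_mx_diag; clearbody y.
  by rewrite !mxE normCK mulrAC mulrC [_^* * _]mulrC.
by apply: sumr_ge0 => i _; rewrite mulr_ge0// exprn_ge0.
Qed.

(** Unitarity gives [P^t* *m P = 1], so at a unit vector [c] minus the form is itself a congruent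
    diagonal form, with the nonnegative entries [c - d_i]. *)
Lemma qform_unitary_diag_le P d (c : R[i]) x : P \is unitarymx ->
  (forall i, d 0 i <= c) -> l2norm x = 1 ->
  qform (P^t* *m diag_mx d *m P) x <= c.
Proof.
move=> Pu dc x1; rewrite -subr_ge0.
pose e : 'rV[R[i]]_N := const_mx c - d.
have /mulmx1C PP := unitarymxP Pu.
have <- : qform (P^t* *m diag_mx e *m P) x =
    c - qform (P^t* *m diag_mx d *m P) x.
  have -> : P^t* *m diag_mx e *m P =
      c *: 1%:M + (-1) *: (P^t* *m diag_mx d *m P).
    rewrite /e linearB /= diag_const_mx mulmxBr mulmxBl scaleN1r.
    by rewrite mul_mx_scalar -scalemxAl PP.
  by rewrite qformD !qformZ qform1// mulr1 mulN1r.
by apply: qform_congr_diag_ge0 => i; rewrite !mxE subr_ge0.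
Qed.

(** From [A = P^-1 D P] follows [P A = D P]: the rows of [P] are left eigenvectors, and they are
    nonzero because [P] is invertible. *)
Lemma eigenvalue_spectral_diag A i :
  A \is normalmx -> eigenvalue A (spectral_diag A 0 i).
Proof.
move=> /orthomx_spectralP; set P := spectralmx A; set d := spectral_diag A.
have Pu : P \in unitmx by apply: spectral_unit.
move=> AE; apply/eigenvalueP; exists (row i P).
  rewrite -row_mul [in LHS]AE !mulmxA mulmxV// mul1mx row_mul.
  by rewrite row_diag_mx -scalemxAl -rowE.
apply/eqP => P0; have := congr1 (row i) (mulmxV Pu).
rewrite row_mul P0 mul0mx => /rowP/(_ i).
by rewrite !mxE eqxx => /esym/eqP; rewrite oner_eq0.
Qed.

(** Upper half of the Rayleigh principle: after unitary diagonalization every diagonal entry is an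
    eigenvalue, hence at most [r]. *)
Lemma qform_le_largest_eigenvalue A (r : R) x : A \is hermsymmx ->
  is_largest_eigenvalue A r -> l2norm x = 1 -> qform A x <= r%:C.
Proof.
move=> /hermitian_normalmx nA [_ rmax] x1.
have Pu := spectral_unitarymx A.
rewrite [X in qform X _](orthomx_spectralP nA) invmx_unitary//.
apply: qform_unitary_diag_le => // i.
exact/rmax/eigenvalue_spectral_diag.
Qed.

(** Since [eigenvalue] speaks of row vectors [v] with [v *m A = z *: v], the witness is the
    normalized conjugate transpose of [v]. *)
Lemma eigenvalue_qform A (z : R[i]) :
  eigenvalue A z -> exists2 x, l2norm x = 1 & qform A x = z.
Proof.
move=> /eigenvalueP[v vA v0].
pose s := \sum_i `|v 0 i| ^+ 2.
have sE : v *m v^t* = s%:M.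
  apply/matrixP => i j; rewrite !ord1 !mxE eqxx mulr1n.
  by apply: eq_bigr => k _; rewrite !mxE -normCK.
have s0 : 0 < s.
  rewrite lt_def sumr_ge0 ?andbT => [|i _]; last by rewrite exprn_ge0.
  apply: contraNneq v0 => /eqP; rewrite psumr_eq0 => [|i _]; last first.
    by rewrite exprn_ge0.
  move=> /allP h; apply/eqP/rowP => j.
  have := h j (mem_index_enum j).
  by rewrite mxE /= expf_eq0 normr_eq0 => /eqP.
(* The scaling factor is real, so conjugation fixes it and [x^t*] is again a multiple of [v]. *)
pose c := (sqrtC s)^-1.
have c0 : 0 <= c by rewrite invr_ge0 sqrtC_ge0 ltW.
pose x := c *: v^t*.
have xt : x^t* = c *: v.
  by rewrite /x linearZ map_mxZ/= trmxCK geC0_conj.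
have x1 : x^t* *m x = 1%:M.
  rewrite xt /x -scalemxAl -scalemxAr sE scalerA scale_scalar_mx.
  by rewrite -expr2 /c exprVn sqrtCK mulVf// gt_eqF.
exists x; first exact/l2norm_eq1.
rewrite /qform xt -scalemxAl vA scalerA mulrC -scalerA -xt -scalemxAl x1.
by rewrite !mxE mulr1.
Qed.

Lemma hermsymmx_comb (a b : R) A B : A \is hermsymmx -> B \is hermsymmx ->
  a%:C *: A + b%:C *: B \is hermsymmx.
Proof.
move=> /is_hermitianmxP; rewrite expr0 scale1r => hA.
move=> /is_hermitianmxP; rewrite expr0 scale1r => hB.
apply/is_hermitianmxP; rewrite expr0 scale1r linearD !linearZ/=.
by rewrite map_mxD !map_mxZ /= -hA -hB !conj_Creal ?complex_real.
Qed.

Lemma hermsymmx_congr_diag P d :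
  (forall i, d 0 i \is Num.real) -> P^t* *m diag_mx d *m P \is hermsymmx.
Proof.
move=> dR; apply/is_hermitianmxP; rewrite expr0 scale1r.
rewrite !trmx_mul !map_mxM trmxCK tr_diag_mx map_diag_mx mulmxA.
suff -> : map_mx Num.conj d = d by [].
by apply/rowP => i; rewrite mxE conj_Creal.
Qed.

(** Taking real parts is linear over the reals, so a linear form on the joint range is the quadratic
    form of one matrix. *)
Lemma Re_qform_comb (a b : R) A B x :
  a * complex.Re (qform A x) + b * complex.Re (qform B x) =
  complex.Re (qform (a%:C *: A + b%:C *: B) x).
Proof.
rewrite qformD !qformZ raddfD /=.
by case: (qform A x) => ? ?; case: (qform B x) => ? ? /=; rewrite !mul0r !subr0.
Qed.

Lemma numerical_range2_le (a b : R) A B : (0 < N)%N ->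
  A \is hermsymmx -> B \is hermsymmx ->
  numerical_range2 A B `<=`
    [set p | a * p.1 + b * p.2 <= largest_eigenvalue (a%:C *: A + b%:C *: B)].
Proof.
move=> N0 hA hB p [x /= x1 <-]; rewrite Re_qform_comb /=.
have hC := hermsymmx_comb a b hA hB.
rewrite -lecR qform_real//.
exact: qform_le_largest_eigenvalue hC (largest_eigenvalueP N0 hC) x1.
Qed.

Lemma largest_eigenvalue_supporting_line (a b : R) A B : (0 < N)%N ->
  A \is hermsymmx -> B \is hermsymmx -> (a, b) != (0, 0) ->
  is_supporting_line
    [set p | a * p.1 + b * p.2 = largest_eigenvalue (a%:C *: A + b%:C *: B)]
    (numerical_range2 A B).
Proof.
move=> N0 hA hB ab0; set r := largest_eigenvalue _.
have [/eigenvalue_qform[x x1 xr] _] :=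
  largest_eigenvalueP N0 (hermsymmx_comb a b hA hB).
exists a, b, r; split=> //; last by left; apply: numerical_range2_le.
(* The point of contact comes from a unit vector at which the form attains the largest
   eigenvalue. *)
exists (complex.Re (qform A x), complex.Re (qform B x)); split; last by exists x.
by rewrite /= Re_qform_comb xr.
Qed.

Lemma Re_qform_unitary_diag P d x : P \is unitarymx ->
  (forall i, 0 <= d 0 i <= 1) -> l2norm x = 1 ->
  0 <= complex.Re (qform (P^t* *m diag_mx d *m P) x) <= 1.
Proof.
move=> Pu d01 x1; rewrite -!lecR qform_real; last first.
  by apply: hermsymmx_congr_diag => i; rewrite ger0_real//; case/andP: (d01 i).
rewrite qform_congr_diag_ge0 => [|i]; last by case/andP: (d01 i).
by rewrite qform_unitary_diag_le// => i; case/andP: (d01 i).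
Qed.

End QuadraticForm.

(** A product of three unitary factors; the diagonal one has entries of modulus 1. *)
Lemma gfrft_unitary (R : realType) (N : nat) (Q : 'M[R[i]]_N)
    (theta : 'I_N -> R) (alpha : R) :
  Q \is unitarymx -> gfrft Q theta alpha \is unitarymx.
Proof.
move=> Qu; rewrite !mul_unitarymx ?trmxC_unitary//; apply/unitarymxP.
rewrite tr_diag_mx map_diag_mx mulmx_diag -diag_const_mx; congr diag_mx.
apply/rowP => i; rewrite !mxE /expi; simpc.
by rewrite -!expr2 cos2Dsin2 mulrC addNr.
Qed.

(** Conjugating a phase negates its angle. This exhibits the filter matrix of [g] as a unitary
    congruence of a diagonal matrix. *)
Lemma gfrftN (R : realType) (N : nat) (Q : 'M[R[i]]_N)
    (theta : 'I_N -> R) (alpha : R) :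
  gfrft Q theta (- alpha) = (gfrft Q theta alpha)^t*.
Proof.
rewrite /gfrft !trmx_mul !map_mxM trmxCK tr_diag_mx map_diag_mx mulmxA.
congr (_ *m diag_mx _ *m _); apply/rowP => i.
by rewrite !mxE /expi mulNr cosN sinN.
Qed.

Theorem theorem4 (R : realType) (N : nat)
    (W U : 'M[R]_N) (xi : 'rV[R]_N)
    (Q : 'M[R[i]]_N) (lambda : 'rV[R[i]]_N) (theta : 'I_N -> R)
    (alpha : R) (f g : 'cV[R]_N)
    (hW : is_weighted_graph W)
    (hU : is_laplacian_eigenbasis W U xi)
    (hQ : is_gft_eigenbasis U Q lambda theta)
    (hf : forall i, 0 <= f i 0 <= 1)
    (hg : forall i, 0 <= (gfrft Q theta alpha *m cmx g) i 0 <= 1)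
    (hf1 : mx_norm f = 1)
    (hg1 : mx_norm (gfrft Q theta alpha *m cmx g) = 1) :
  let Df := filter_mx f in
  let Bg := gfrft_filter_mx Q theta alpha g in
  let rho1 (beta : R) :=
    largest_eigenvalue ((cos beta)%:C *: Df + (sin beta)%:C *: Bg) in
  forall beta : R, 0 <= beta < 2 * pi ->
    numerical_range2 Df Bg `<=`
      [set p : R * R | [/\ 0 <= p.1 <= 1, 0 <= p.2 <= 1
                 & cos beta * p.1 + sin beta * p.2 <= rho1 beta]] /\
    is_supporting_line
      [set p : R * R | cos beta * p.1 + sin beta * p.2 = rho1 beta]
      (numerical_range2 Df Bg).
Proof.
move=> Df Bg rho1 beta _.
have N0 : (0 < N)%N.
  (* [mx_norm] of an empty matrix is 0, so [hf1] excludes [N = 0]. *)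
  case: N f hf1 {W U xi Q lambda theta g hW hU hQ hf hg hg1 Df Bg rho1} => // f.
  by rewrite (flatmx0 f) mx_norm0 => /esym/eqP; rewrite oner_eq0.
have [Qu _ _] := hQ; have Fu := gfrft_unitary theta alpha Qu.
(* Written with the identity as unitary factor, [Df] falls under the same lemmas as [Bg]. *)
have DfE : Df = (1%:M)^t* *m diag_mx (cmx f)^T *m 1%:M.
  by rewrite trmx1 map_mx1 mul1mx mulmx1.
have u1 : (1%:M : 'M[R[i]]_N) \is unitarymx.
  by apply/unitarymxP; rewrite trmx1 map_mx1 mul1mx.
have BgE : Bg = (gfrft Q theta alpha)^t* *m
    diag_mx (gfrft Q theta alpha *m cmx g)^T *m gfrft Q theta alpha.
  by rewrite /Bg /gfrft_filter_mx gfrftN.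
have f01 i : 0 <= (cmx f)^T 0 i <= 1 by rewrite !mxE !lecR hf.
have g01 i : 0 <= (gfrft Q theta alpha *m cmx g)^T 0 i <= 1 by rewrite mxE hg.
have hDf : Df \is hermsymmx.
  rewrite DfE; apply: hermsymmx_congr_diag => i.
  by rewrite ger0_real//; case/andP: (f01 i).
have hBg : Bg \is hermsymmx.
  rewrite BgE; apply: hermsymmx_congr_diag => i.
  by rewrite ger0_real//; case/andP: (g01 i).
split.
  move=> p pG; split; last exact: numerical_range2_le pG.
    by case: pG => x /= x1 <-; rewrite /= DfE Re_qform_unitary_diag.
  by case: pG => x /= x1 <-; rewrite /= BgE Re_qform_unitary_diag.
apply: largest_eigenvalue_supporting_line => //.
(* The normal vector of the line is a unit vector, hence nonzero. *)
apply/eqP => -[c0 s0]; have := cos2Dsin2 beta.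
by rewrite c0 s0 expr0n addr0 => /esym/eqP; rewrite oner_eq0.
Qed.
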